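(* Let $q=p^{\alpha}$ with $p$ prime, list the elements of $GF(q)$ as $a_0=0,a_1,\dots,a_{q-1}$, let $t$ be an integer with $1\le t<\frac{q-1}{2}$, and let $A$ be the $q\times q$ matrix over $GF(q)$ with entries $a_{ij}=a_j^t-a_i^t$. Let $r\in GF(q)$ be nonzero and set $W=A+rI$. For a plaintext column vector $M\in GF(q)^q$ let the ciphertext be $C=WM$. Let $l\in GF(q)$ be the solution of $r^2x=1$. Then the decrypted message $D=lW^TC$ is uniquely determined and $D=M$ (all arithmetic in $GF(q)$; for $\alpha=1$ this is arithmetic modulo $p$).
   Context: This is the decryption step of an encryption scheme: the key matrix $W=A+rI$ satisfies $WW^T=r^2I$ over $GF(q)$, a message is encoded as a vector $M$ of field elements, encrypted as $C=WM$, and decrypted as $lW^TC$. *)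

(* Defs.v *)
From mathcomp Require Import all_boot all_algebra.

Set Implicit Arguments.
Unset Strict Implicit.
Unset Printing Implicit Defensive.

Import GRing.Theory.
Local Open Scope ring_scope.

Definition diffpow_mx (F : finFieldType) (q : nat) (a : 'I_q -> F) (t : nat) :
    'M[F]_q :=
  \matrix_(i, j) (a j ^+ t - a i ^+ t).

Definition key_mx (F : finFieldType) (q : nat) (a : 'I_q -> F) (t : nat)
    (r : F) : 'M[F]_q :=
  diffpow_mx a t + r%:M.

Definition encrypt (F : finFieldType) (q : nat) (W : 'M[F]_q) (M : 'cV[F]_q) :
    'cV[F]_q :=
  W *m M.

(* [l] is meant to be the solution of r ^+ 2 * x = 1. *)
Definition decrypt (F : finFieldType) (q : nat) (W : 'M[F]_q) (l : F)
    (C : 'cV[F]_q) : 'cV[F]_q :=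
  l *: (W^T *m C).

(* Main.v *)
(* Expanding [W^T W = (A^T + r)(A + r)], the linear terms cancel because [A] is
   antisymmetric, and the entries of [A^T A] are combinations of the power sums
   of exponents 0, t and 2t over the field, which vanish as 2t < q - 1. *)
Require Import Defs.
From mathcomp Require Import all_boot all_algebra.

Set Implicit Arguments.
Unset Strict Implicit.
Unset Printing Implicit Defensive.

Import GRing.Theory.
Local Open Scope ring_scope.

(** Otherwise ['X^(n.+1) - 'X] would vanish on all of [F], although its degree [n.+1] is below
    [#|F|]. The extra factor ['X] makes 0 a root too, so the whole of [enum F] serves as the list of
    roots. *)
Lemma exists_expf_neq1 (F : finFieldType) (n : nat) :
  (0 < n)%N -> (n < #|F| - 1)%N -> exists2 g : F, g != 0 & g ^+ n != 1.
Proof.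
move=> n_gt0 n_lt.
have [g /andP[g0 gn] | all1] := pickP (fun g : F => (g != 0) && (g ^+ n != 1)).
  by exists g.
have szP : size ('X^(n.+1) - 'X : {poly F}) = n.+2.
  by rewrite size_polyDl ?size_polyN size_polyXn ?size_polyX.
have P0 : ('X^(n.+1) - 'X : {poly F}) != 0 by rewrite -size_poly_gt0 szP.
have rootsP : all (root ('X^(n.+1) - 'X)) (enum F).
  apply/allP=> g _; rewrite rootE !hornerE subr_eq0.
  have [->|g0] := eqVneq g 0; first by rewrite expr0n.
  by have := all1 g; rewrite g0 => /negbFE/eqP gn; rewrite exprS gn mulr1.
have := max_poly_roots P0 rootsP (enum_uniq F).
by rewrite -cardE szP ltnS leqNgt -[n.+1]add1n -ltn_subRL n_lt.
Qed.

(* Multiplying the summation variable by some g with g^n != 1 scales the sum. *)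
Lemma sum_expf_eq0 (F : finFieldType) (n : nat) :
  (0 < n)%N -> (n < #|F| - 1)%N -> \sum_(x : F) x ^+ n = 0.
Proof.
move=> n_gt0 n_lt; have [g g0 gn] := exists_expf_neq1 n_gt0 n_lt.
set S := \sum_x _.
have scaleS : S = g ^+ n * S.
  rewrite {1}/S (reindex_inj (mulfI g0)) mulr_sumr.
  by apply: eq_bigr => x _; rewrite exprMn.
have /eqP : (1 - g ^+ n) * S = 0 by rewrite mulrBl mul1r -scaleS subrr.
by rewrite mulf_eq0 subr_eq0 eq_sym (negbTE gn) => /eqP.
Qed.

(** Translation by 1 permutes [F], so it leaves the sum of all elements unchanged, yet adds [#|F|]
    ones to it. *)
Lemma card_finField_natr0 (F : finFieldType) : #|F|%:R = 0 :> F.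
Proof.
have : \sum_(x : F) x = \sum_(x : F) (1 + x).
  by rewrite (reindex_inj (addrI 1)).
by rewrite big_split sumr_const -{1}[\sum_x x]add0r => /addIr/esym.
Qed.

Lemma diffpow_mx_tr (F : finFieldType) (q : nat) (a : 'I_q -> F) (t : nat) :
  (diffpow_mx a t)^T = - diffpow_mx a t.
Proof. by apply/matrixP=> i j; rewrite !mxE opprB. Qed.

Lemma diffpow_mx_sqr0 (F : finFieldType) (q : nat) (a : 'I_q -> F) (t : nat) :
  #|F| = q -> bijective a -> (0 < t)%N -> (2 * t < q - 1)%N ->
  diffpow_mx a t *m diffpow_mx a t = 0.
Proof.
move=> card_F a_bij t_gt0 t2_lt.
have sum_pow n : (0 < n)%N -> (n < q - 1)%N -> \sum_k a k ^+ n = 0.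
  move=> n_gt0 n_lt; have := @sum_expf_eq0 F n n_gt0.
  by rewrite card_F (reindex a) => [-> //|]; apply: onW_bij.
have t_lt : (t < q - 1)%N by apply: leq_ltn_trans t2_lt; rewrite leq_pmull.
apply/matrixP=> i j; rewrite !mxE.
(* Each summand becomes a combination of [a k ^+ t], [a k ^+ (2 * t)] and a term free of [k]; the
   latter is summed [q] times and dies because [q%:R = 0] in [F]. *)
under eq_bigr => k _.
  rewrite !mxE mulrBl !mulrBr -exprD addnn -mul2n [a k ^+ t * _]mulrC.
  over.
have q0 : q%:R = 0 :> F by rewrite -card_F card_finField_natr0.
rewrite !sumrB -!mulr_sumr sumr_const card_ord -mulr_natr q0.
by rewrite !sum_pow ?muln_gt0 // !mulr0 !subr0.
Qed.

Lemma key_mx_tr_mul (F : finFieldType) (q : nat) (a : 'I_q -> F) (t : nat)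
    (r : F) :
  #|F| = q -> bijective a -> (0 < t)%N -> (2 * t < q - 1)%N ->
  (key_mx a t r)^T *m key_mx a t r = (r ^+ 2)%:M.
Proof.
move=> card_F a_bij t_gt0 t2_lt.
rewrite /key_mx [_^T]linearD /= diffpow_mx_tr tr_scalar_mx mulmxDl !mulmxDr.
(* With the transpose of A equal to -A, the quadratic term is minus the square of A, hence zero; the
   cross terms cancel since scalar matrices are central. *)
rewrite !mulNmx diffpow_mx_sqr0 // oppr0 add0r -scalar_mxC addrA addNr add0r.
by rewrite -scalar_mxM.
Qed.

Theorem theorem6 (p alpha q : nat) (F : finFieldType) (a : 'I_q -> F)
    (t : nat) (r : F) (M : 'cV[F]_q)
    (p_prime : prime p) (alpha_gt0 : (0 < alpha)%N)
    (q_def : q = (p ^ alpha)%N) (card_F : #|F| = q)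
    (a_bij : bijective a)
    (a0 : forall i : 'I_q, val i = 0%N -> a i = 0)
    (t_ge1 : (1 <= t)%N) (t_lt : (2 * t < q - 1)%N)
    (r_neq0 : r <> 0) :
  let W := key_mx a t r in
  let C := encrypt W M in
  [/\ exists! l : F, r ^+ 2 * l = 1,
      exists! D : 'cV[F]_q,
        exists l : F, r ^+ 2 * l = 1 /\ D = decrypt W l C
    & forall (l : F) (D : 'cV[F]_q),
        r ^+ 2 * l = 1 -> D = decrypt W l C -> D = M].
Proof.
move=> W C.
have r2_neq0 : r ^+ 2 != 0 by rewrite expf_neq0 //; apply/eqP.
(* Decryption multiplies [M] by [l * r ^+ 2], so every admissible [l] returns [M]; this gives both
   the uniqueness and the value of the decrypted message. *)
have decryptK l : r ^+ 2 * l = 1 -> decrypt W l C = M.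
  move=> rl1; rewrite /decrypt /C /encrypt mulmxA key_mx_tr_mul //.
  by rewrite mul_scalar_mx scalerA mulrC rl1 scale1r.
have rV1 : r ^+ 2 * (r ^+ 2)^-1 = 1 by rewrite divff.
split.
- exists (r ^+ 2)^-1; split=> // l rl1.
  by apply: (mulfI r2_neq0); rewrite rV1 rl1.
- exists M; split; first by exists (r ^+ 2)^-1; rewrite decryptK.
  by move=> D [l [rl1 ->]]; rewrite decryptK.
- by move=> l D rl1 ->; apply: decryptK.
Qed.
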